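(* Let $n\geq 2$ and let $x$ be a $2$-element of the symmetric group $S_n$. Then $x$ lies in a unique Sylow $2$-subgroup of $S_n$ if and only if $x$ has at most two fixed points and all cycles of $x$ (in its disjoint cycle decomposition) of length bigger than one have pairwise different lengths. *)

(* Defs.v *)
From mathcomp Require Import all_boot all_fingroup all_solvable.
Local Open Scope group_scope.
Set Implicit Arguments. Unset Strict Implicit. Unset Printing Implicit Defensive.

Definition fixed_points n (x : 'S_n) : {set 'I_n} := [set i | x i == i].

(* The cycles of x (in its disjoint cycle decomposition) are the orbits
   porbits x; a cycle's length is the cardinality of its orbit.
   "All cycles of length > 1 have pairwise different lengths". *)
Definition nontriv_cycle_lengths_distinct n (x : 'S_n) : Prop :=
  forall A B, A \in porbits x -> B \in porbits x ->
    (1 < #|A|)%N -> #|A| = #|B| -> A = B.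

(* Main.v *)
Require Import Defs.
From mathcomp Require Import all_boot all_fingroup all_solvable.
From mathcomp Require Import zify.
Local Open Scope group_scope.

(** Uniqueness of the Sylow subgroup follows once any two 2-groups [P] and [Q]
    of permutations containing [x] generate a 2-group.  A 2-group of
    permutations is centralised by an involution [z] with at most one fixed
    point.  When [x] has at most two fixed points and its nontrivial cycles have
    distinct lengths, such a [z] commuting with [x] is determined by [x]: it is
    the half-turn on each nontrivial cycle and swaps two fixed points of [x].
    Hence [P] and [Q] centralise the same [z] and act on the set of [z]-orbits;
    the kernel of this action is a 2-group, [x] still satisfies the cycle
    condition there, and one concludes by induction on the number of points.

    Conversely, if [P] is the only Sylow 2-subgroup containing [x], it contains
    every 2-group containing [x], in particular every transposition whose
    conjugates under [<[x]>] commute pairwise.  Three fixed points [u], [v], [w],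
    or [u], [x ^+ k u] and [v] with [u], [v] on different cycles of length [2k],
    give two such transpositions [(u v)] and [(u w)] whose product is a
    3-cycle. *)

(** * Cycle lengths and powers of a permutation *)

Lemma card_porbit_gt0 {T : finType} (x : {perm T}) u : 0 < #|porbit x u|.
Proof. by apply/card_gt0P; exists u; apply: porbit_id. Qed.

(** The iterates [(x ^+ r) u] with [r < N] are pairwise distinct, so only exponents with remainder 0
    return to [u]. *)
Lemma porbit_expE {T : finType} (x : {perm T}) u k :
  ((x ^+ k) u == u) = (#|porbit x u| %| k).
Proof.
set N := #|porbit x u|; have N0 : 0 < N := card_porbit_gt0 x u.
have xN : (x ^+ N) u = u by rewrite permX iter_porbit.
have xNm m : (x ^+ (m * N)) u = u.
  by elim: m => [|m IHm]; rewrite ?perm1 // mulSn expgD permM xN.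
rewrite {1}(divn_eq k N) expgD permM xNm permX /dvdn.
have lt_r := ltn_pmod k N0; set r := k %% N in lt_r *.
have := uniq_traject_porbit x u => /(nth_uniq u) eq_nth.
by have := eq_nth r 0; rewrite size_traject !nth_traject // => ->.
Qed.

Lemma card_porbit_eq1 {T : finType} (x : {perm T}) u :
  (#|porbit x u| == 1%N) = (x u == u).
Proof. by rewrite -dvdn1 -porbit_expE expg1. Qed.

Lemma perm_commute {T : finType} {s t : {perm T}} u : commute s t -> s (t u) = t (s u).
Proof. by move=> /(congr1 (fun p : {perm T} => p u)); rewrite !permM => ->. Qed.

Lemma card_porbit_commute {T : finType} (s x : {perm T}) u :
  commute s x -> #|porbit x (s u)| = #|porbit x u|.
Proof.
move=> csx; apply/eqP; rewrite eqn_dvd -!porbit_expE; apply/andP; split.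
  by rewrite -(perm_commute u (commuteX _ csx)) permX iter_porbit.
rewrite -(inj_eq (@perm_inj _ s)) (perm_commute u (commuteX _ csx)).
by rewrite permX iter_porbit.
Qed.

(** * Cycle conditions and involutions centralising a 2-group *)

Definition few_fixed {T : finType} (x : {perm T}) :=
  forall u v w, x u = u -> x v = v -> x w = w -> [|| u == v, v == w | w == u].

(** Phrased with points and over any finite type, so that the induction can pass to a set of
    orbits. *)
Definition distinct_cycles {T : finType} (x : {perm T}) :=
  forall u v, x u != u -> #|porbit x u| = #|porbit x v| -> v \in porbit x u.

(* The identity qualifies when [T] has at most one element. *)
Definition near_fpf_involution {T : finType} (z : {perm T}) :=
  z ^+ 2 = 1 /\ forall u v, z u = u -> z v = v -> u = v.

Lemma involution_permK {T : finType} (z : {perm T}) : z ^+ 2 = 1 -> involutive z.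
Proof. by move=> z2 u; rewrite -permM -[z * z]/(z ^+ 2) z2 perm1. Qed.

Lemma commute_fixed {T : finType} (s t : {perm T}) u :
  commute s t -> (s (t u) == t u) = (s u == u).
Proof. by move=> cst; rewrite (perm_commute u cst) (inj_eq perm_inj). Qed.

(** If [P] acts trivially on [F], any transposition inside [F] serves. Otherwise the restriction of
    [P] to [F] is a nontrivial 2-group [K], and an involution of ['Z(K)] serves, being trivial off
    [F]. *)
Lemma cent_involution_on {T : finType} (P : {group {perm T}}) (F : {set T}) :
    2.-group P -> P \subset 'N(F | 'P) -> 1 < #|F| ->
  exists w : {perm T}, [/\ w \in 'C(P), w ^+ 2 = 1, w != 1 & perm_on F w].
Proof.
move=> pP nFP F2; pose f := restr_perm_morphism F; pose K := (f @* P)%G.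
have pK : 2.-group K by apply: morphim_pgroup.
have [K1 | ntK] := eqVneq (K : {set _}) 1.
  case/card_gt1P: F2 => u [v] [Fu Fv uv].
  have fixF g a : g \in P -> a \in F -> g a = a.
    move=> Pg Fa; have gN := subsetP nFP g Pg.
    rewrite -(restr_permE gN Fa) (_ : restr_perm F g = 1) ?perm1 //.
    by apply/set1P; rewrite -[[set 1]]K1; apply: mem_morphim.
  exists (tperm u v); split.
  - apply/centP=> g Pg; apply/commgP/conjg_fixP.
    by rewrite tpermJ !fixF.
  - by apply/permP=> a; rewrite expgS expg1 permM tpermK perm1.
  - by apply/eqP=> /permP/(_ u); rewrite tpermL perm1 => /esym/eqP; apply/negP.
  - by apply/subsetP=> a; rewrite inE; case: tpermP => [->|->|_ _]; rewrite ?eqxx.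
have ntZ : 'Z(K) != 1 by rewrite center_nil_eq1 ?(pgroup_nil pK).
have pZ : 2.-group 'Z(K) := pgroupS (center_sub _) pK.
have [_ dvZ _] := pgroup_pdiv pZ ntZ.
have [w Zw ow] := Cauchy (isT : prime 2) dvZ.
case/centerP: (Zw) => Kw cKw.
have onw : perm_on F w.
  by case/morphimP: Kw => g _ _ ->; apply: restr_perm_on.
exists w; split=> //; last 1 first.
- by rewrite -order_eq1 ow.
- apply/centP=> g Pg; apply/permP=> a; rewrite !permM.
  have gN := subsetP nFP g Pg.
  have ga b : (g b \in F) = (b \in F) by exact: astabs_act gN.
  have [Fa | nFa] := boolP (a \in F); last first.
    by rewrite !(out_perm onw) ?ga.
  rewrite -(restr_permE gN Fa) -(restr_permE gN) ?perm_closed //.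
  by rewrite (perm_commute a (cKw _ (mem_morphim f gN Pg))).
- by rewrite -ow expg_order.
Qed.

(* If an involution centralising [P] has two fixed points, its fixed-point set
   supports another one, and their product fixes fewer points. *)
Lemma near_fpf_involution_exists {T : finType} (P : {group {perm T}}) :
  2.-group P -> exists2 z : {perm T}, z \in 'C(P) & near_fpf_involution z.
Proof.
move=> pP; pose good z := (z \in 'C(P)) && (z ^+ 2 == 1).
have good1 : good 1 by rewrite /good group1 expg1n eqxx.
pose F (z : {perm T}) := [set a | z a == a].
case: (arg_minnP (fun z => #|F z|) good1) => z /andP[cz /eqP z2] zmin.
exists z => //; split=> // u v zu zv; apply/eqP; apply: contraT => uv.
have nFP : P \subset 'N(F z | 'P).
  apply/subsetP=> g Pg; apply/astabsP=> a; rewrite !inE.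
  by rewrite (commute_fixed z g a) //; apply: (centP cz).
have F2 : 1 < #|F z| by apply/card_gt1P; exists u, v; rewrite !inE zu zv !eqxx.
have [w [cw w2 w1 onw]] := cent_involution_on P _ pP nFP F2.
have zK := involution_permK z z2; have wK := involution_permK w w2.
have Fzz a : (z a \in F z) = (a \in F z) by rewrite !inE zK eq_sym.
have Fzw a : (w a \in F z) = (a \in F z) by rewrite perm_closed.
(* The supports are disjoint: [z] is trivial on [F z], and [w] outside it. *)
have czw : commute z w.
  apply/permP=> a; rewrite !permM.
  have [Fa | nFa] := boolP (a \in F z).
    have := Fa; rewrite inE => /eqP ->.
    by move: Fa; rewrite -Fzw inE => /eqP ->.
  by rewrite !(out_perm onw) ?Fzz.
have /zmin : good (z * w) by rewrite /good groupM // expgMn // z2 w2 mulg1 eqxx.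
rewrite leqNgt => /negP[]; apply: proper_card; apply/properP; split.
  apply/subsetP=> a; rewrite !inE permM => /eqP zwa.
  have [|nFa] := boolP (a \in F z); first by rewrite inE.
  by rewrite -{2}zwa (out_perm onw) ?Fzz.
have [a wa] : exists a, w a != a.
  apply/existsP; apply: contraR w1 => /existsPn w1.
  by apply/eqP/permP=> a; rewrite perm1; apply/eqP; rewrite -[_ == _]negbK.
have Fa : a \in F z by apply: contraR wa => /(out_perm onw) ->.
by exists a => //; move: Fa; rewrite !inE permM => /eqP ->.
Qed.

Lemma card_porbit_gt1 {T : finType} (x : {perm T}) u :
  (x u != u) = (1 < #|porbit x u|).
Proof. by rewrite -card_porbit_eq1 -(prednK (card_porbit_gt0 x u)) ltnS lt0n. Qed.

Lemma mem_porbit_lt {T : finType} (x : {perm T}) u v :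
  v \in porbit x u -> exists2 k, k < #|porbit x u| & v = (x ^+ k) u.
Proof.
rewrite porbit_traject => /trajectP[k lt_k ->].
by exists k; rewrite ?permX.
Qed.

(** * Involutions commuting with a permutation *)

Section CentralInvolution.
Variables (T : finType) (x : {perm T}).
Hypotheses (ffx : few_fixed x) (dcx : distinct_cycles x).

(** If [z] fixed [u], it would also fix [x u]. *)
Lemma near_fpf_moves z u : near_fpf_involution z -> commute z x -> x u != u ->
  z u != u.
Proof.
case=> _ zfix czx xu; apply: contra xu => /eqP zu.
by rewrite (zfix (x u) u) // (perm_commute u czx) zu.
Qed.

(** The cycles of [u] and [z u] have equal length, hence coincide. Writing [z u = (x ^+ k) u] with
    [k] below this length, [z ^+ 2 = 1] makes the length divide [2k], and [k] is nonzero since [z]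
    moves [u]. *)
Lemma near_fpf_on_cycle z u : near_fpf_involution z -> commute z x -> x u != u ->
  exists2 k, k.*2 = #|porbit x u| & z u = (x ^+ k) u.
Proof.
move=> nz czx xu; have zu := near_fpf_moves z u nz czx xu.
have /mem_porbit_lt[k ltk zuk] : z u \in porbit x u.
  by apply: dcx; rewrite ?card_porbit_commute.
exists k => //; have: #|porbit x u| %| k.*2.
  rewrite -porbit_expE -addnn expgD permM -zuk -(perm_commute u (commuteX k czx)).
  by rewrite -zuk involution_permK //; case: nz.
case/dvdnP=> -[|[|m]]; rewrite ?mul0n ?mul1n //.
  by move=> k0; rewrite zuk (_ : k = 0) ?perm1 ?eqxx // in zu; lia.
by nia.
Qed.

(** [z] permutes the fixed points of [x]; these are only [u] and [v], and [z] cannot fix both. *)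
Lemma near_fpf_swap z u v : near_fpf_involution z -> commute z x ->
  x u = u -> x v = v -> u != v -> z u = v.
Proof.
move=> [z2 zfix] czx xu xv uv; have zK := involution_permK z z2.
have fz a : x a = a -> x (z a) = z a by move=> xa; rewrite -(perm_commute a czx) xa.
have zmv a b : x a = a -> x b = b -> a != b -> z a != a.
  move=> xa xb ab; apply/eqP=> za; case/or3P: (ffx a b (z b) xa xb (fz b xb)).
  - by apply/negP.
  - by move/eqP=> zb; rewrite (zfix a b) ?eqxx // in ab.
  - by rewrite -{1}za (inj_eq perm_inj) eq_sym; apply/negP.
have := zmv u v xu xv uv.
case/or3P: (ffx u v (z u) xu xv (fz u xu)) => [/eqP eq_uv|/eqP->|->] //.
by rewrite eq_uv eqxx in uv.
Qed.

Lemma near_fpf_unique z z' : near_fpf_involution z -> commute z x ->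
  near_fpf_involution z' -> commute z' x -> z = z'.
Proof.
move=> nz czx nz' czx'; apply/permP=> u.
have [xu | xu] := eqVneq (x u) u; last first.
  have [k dk ->] := near_fpf_on_cycle z u nz czx xu.
  have [k' dk' ->] := near_fpf_on_cycle z' u nz' czx' xu.
  by rewrite (_ : k = k') //; lia.
have fz s : commute s x -> x (s u) = s u.
  by move=> csx; rewrite -(perm_commute u csx) xu.
(* If either involution moves [u], the image is a second fixed point of [x], and the other must send
   [u] there too. *)
have [zu | zu] := eqVneq u (z u); last first.
  by rewrite (near_fpf_swap z' u (z u)) // fz.
have [zu' | zu'] := eqVneq u (z' u); first by rewrite -zu -zu'.
by rewrite (near_fpf_swap z u (z' u)) // fz.
Qed.

End CentralInvolution.

(** * Action on the orbits of an involution *)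

Lemma porbit_involution {T : finType} (z : {perm T}) u v :
  z ^+ 2 = 1 -> (v \in porbit z u) = (v == u) || (v == z u).
Proof.
move=> z2; apply/idP/orP=> [/porbitP[k ->]|[]/eqP->]; last first.
- exact: (mem_porbit z 1).
- exact: porbit_id.
rewrite (divn_eq k 2) mulnC expgD expgM z2 expg1n mul1g modn2.
by case: odd; [right | left]; rewrite ?expg1 ?perm1.
Qed.

Section Quotient.
Variables (T : finType) (z : {perm T}).
Hypothesis z2 : z ^+ 2 = 1.

Local Notation QT := {A : {set T} | A \in porbits z}.

(** Acting on the subtype of orbits makes the image of a group a permutation group of a finite type
    again, as the induction requires. *)
Definition orbit_act : action (subact_dom (mem (porbits z)) ('P^*)%act) QT :=
  (('P^*)^?)%act.

Definition orbit_perm : {morphism _ >-> {perm QT}} := actperm_morphism orbit_act.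

Definition orbit_class u : QT := exist _ (porbit z u) (imset_f (porbit z) (isT : u \in T)).

Lemma orbit_class_surj (a : QT) : exists u, a = orbit_class u.
Proof. by case: a => A AP; case/imsetP: (AP) => u _ Au; exists u; apply: val_inj. Qed.

Lemma orbit_class_eq u v : (orbit_class u == orbit_class v) = (u == v) || (u == z v).
Proof. by rewrite -val_eqE /= eq_porbit_mem porbit_involution. Qed.

Lemma setact_porbit g u : g \in 'C[z] -> ('P^*)%act (porbit z u) g = porbit z (g u).
Proof.
move=> /cent1P cgz; apply/setP=> a; rewrite porbit_involution //.
apply/imsetP/orP=> [[b]|[]/eqP->].
- rewrite porbit_involution // => /orP[]/eqP-> ->; [by left | right].
  by rewrite /= /aperm (perm_commute u cgz).
- by exists u; rewrite ?porbit_id.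
- by exists (z u); rewrite ?(mem_porbit z 1) //= /aperm (perm_commute u cgz).
Qed.

Lemma cent1_sub_orbit_dom : 'C[z] \subset subact_dom (mem (porbits z)) ('P^*)%act.
Proof.
apply/subsetP=> g cgz; rewrite /subact_dom -astabsIdom.
rewrite inE inE /=; apply/astabsP=> A; rewrite !inE.
have stable h B : h \in 'C[z] -> B \in porbits z -> ('P^*)%act B h \in porbits z.
  by move=> chz /imsetP[u _ ->]; rewrite setact_porbit // imset_f.
apply/idP/idP; last exact: stable.
by move/(stable g^-1 _ (groupVr cgz)); rewrite actK.
Qed.

Lemma orbit_permE g u : g \in 'C[z] -> orbit_perm g (orbit_class u) = orbit_class (g u).
Proof.
move=> cgz; apply: val_inj; rewrite /= actpermE val_subact.
by rewrite (subsetP cent1_sub_orbit_dom) //= setact_porbit.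
Qed.

(** A kernel element sends each [u] to [u] or [z u], hence squares to 1. *)
Lemma orbit_perm_ker_2group : 2.-group ('ker orbit_perm).
Proof.
apply/pgroupP=> p p_pr /(Cauchy p_pr)[g kg og].
have Dg := dom_ker kg; have fg := mker kg.
have gu u : g u \in porbit z u.
  have /(congr1 val) : orbit_perm g (orbit_class u) = orbit_class u.
    by rewrite fg perm1.
  rewrite /= actpermE val_subact Dg /= => <-.
  by apply/imsetP; exists u; rewrite ?porbit_id.
have g2 : g ^+ 2 = 1.
  apply/permP=> u; rewrite expgS expg1 permM perm1.
  have := gu u; rewrite porbit_involution // => /orP[]/eqP gu1; rewrite ?gu1 //.
  have := gu (z u); rewrite porbit_involution // involution_permK //.
  case/orP=> /eqP // gzu; have /perm_inj zu : g (z u) = g u by rewrite gzu gu1.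
  by rewrite gzu zu.
have: p %| 2 by rewrite -og order_dvdn g2.
by rewrite dvdn_prime2 // inE.
Qed.

(** Equality would make [porbit z] injective, although [u] and [z u] share an orbit. *)
Lemma card_orbit_quotient : z != 1 -> #|{: QT}| < #|T|.
Proof.
move=> z1; have -> : #|{: QT}| = #|porbits z| by rewrite card_sig; apply: eq_card.
rewrite ltn_neqAle leq_imset_card andbT.
apply: contra z1 => /eqP eqc; apply/eqP/permP=> u; rewrite perm1.
have inj_p : {in T &, injective (porbit z)} by apply/imset_injP/eqP.
apply: inj_p => //; apply/eqP.
by rewrite eq_porbit_mem (mem_porbit z 1).
Qed.

End Quotient.

(** * Cycle conditions on the set of orbits *)

Section QuotientConditions.
Variables (T : finType) (x z : {perm T}).
Hypotheses (ffx : few_fixed x) (dcx : distinct_cycles x).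
Hypotheses (nz : near_fpf_involution z) (czx : commute z x).
Let z2 : z ^+ 2 = 1. Proof. by case: nz. Qed.
Let zK := involution_permK z z2.
Let cx : x \in 'C[z]. Proof. exact/cent1P. Qed.

Lemma orbit_perm_expE k u :
  (orbit_perm T z x ^+ k) (orbit_class T z u) = orbit_class T z ((x ^+ k) u).
Proof.
elim: k u => [|k IHk] u; first by rewrite !perm1.
by rewrite !expgS !permM orbit_permE // IHk.
Qed.

(** A fixed class consists of fixed points of [x] or is a 2-cycle of [x]. Since [z] swaps two fixed
    points and [x] has at most one 2-cycle, there is at most one class of each kind. *)
Lemma few_fixed_quotient : few_fixed (orbit_perm T z x).
Proof.
move=> a b c; case: (orbit_class_surj _ _ a) => u ->.
case: (orbit_class_surj _ _ b) => v ->; case: (orbit_class_surj _ _ c) => w ->.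
rewrite !orbit_permE // => /eqP + /eqP + /eqP; rewrite !orbit_class_eq //.
have fixed_class s t : x s = s -> x t = t -> (s == t) || (s == z t).
  move=> xs xt; have [//|st] := eqVneq s t.
  by rewrite -(near_fpf_swap T x ffx z s t) // zK eqxx.
have moved_class s t : x s != s -> x t != t -> x s = z s -> x t = z t ->
    (s == t) || (s == z t).
  move=> ms mt xs xt.
  have card2 r : x r != r -> x r = z r -> #|porbit x r| = 2.
    move=> mr xr; have: #|porbit x r| %| 2.
      by rewrite -porbit_expE expgS expg1 permM xr -(perm_commute r czx) xr zK.
    move: mr; rewrite card_porbit_gt1 => r1 /dvdn_leq; lia.
  have /mem_porbit_lt[k] : s \in porbit x t by apply: dcx; rewrite ?card2.
  rewrite card2 // => + ->; case: k => [|[|k]] // _.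
    by rewrite perm1 eqxx.
  by rewrite expg1 xt eqxx orbT.
have cls s : (x s == s) || (x s == z s) -> x s = s \/ x s != s /\ x s = z s.
  by have [|_ /= /eqP] := eqVneq (x s) s; [left | right].
(* Pigeonhole: two of the three classes are of the same kind. *)
move=> /cls[xu|[mu xu]] /cls[xv|[mv xv]] /cls[xw|[mw xw]].
- by rewrite fixed_class.
- by rewrite fixed_class.
- by rewrite (fixed_class w u) ?orbT.
- by rewrite (moved_class v w) ?orbT.
- by rewrite (fixed_class v w) ?orbT.
- by rewrite (moved_class w u) ?orbT.
- by rewrite moved_class.
- by rewrite moved_class.
Qed.

(** The half-turn [z] identifies opposite points of the cycle. *)
Lemma card_porbit_quotient u : x u != u ->
  #|porbit x u| = #|porbit (orbit_perm T z x) (orbit_class T z u)|.*2.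
Proof.
move=> xu; have [k dk zu] := near_fpf_on_cycle T x dcx z u nz czx xu.
set N := #|porbit x u| in dk *; set M := #|_|.
suff -> : M = k by rewrite dk.
apply/eqP; rewrite eqn_dvd -porbit_expE orbit_perm_expE orbit_class_eq //.
rewrite zu eqxx orbT /=.
have : (orbit_perm T z x ^+ M) (orbit_class T z u) == orbit_class T z u.
  by rewrite porbit_expE.
rewrite orbit_perm_expE orbit_class_eq // porbit_expE -/N -dk -muln2.
(* [(x ^+ M) u] is [u] or [z u], so [2k] divides [M] or [k + M]; either way [k] divides [M]. *)
case/orP=> [|/eqP xM]; first by apply: dvdn_trans; apply: dvdn_mulr.
have: N %| k + M.
  rewrite -porbit_expE addnC expgD permM xM -(perm_commute u (commuteX k czx)).
  by rewrite -zu zK.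
by rewrite -dk -muln2 => /(dvdn_trans (dvdn_mulr 2 (dvdnn k))); rewrite dvdn_addr.
Qed.

(** Nontrivial quotient cycles of equal length come from cycles of [x] of twice that length, hence
    from a single one. *)
Lemma distinct_cycles_quotient : distinct_cycles (orbit_perm T z x).
Proof.
move=> a b; case: (orbit_class_surj _ _ a) => u ->.
case: (orbit_class_surj _ _ b) => v -> ma eqc.
have moved s : orbit_perm T z x (orbit_class T z s) != orbit_class T z s -> x s != s.
  by apply: contra => /eqP xs; rewrite orbit_permE // xs.
have mb : orbit_perm T z x (orbit_class T z v) != orbit_class T z v.
  by rewrite card_porbit_gt1 -eqc -card_porbit_gt1.
have /porbitP[k ->] : v \in porbit x u.
  by apply: dcx; rewrite ?card_porbit_quotient ?moved // eqc.
by apply/porbitP; exists k; rewrite orbit_perm_expE.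
Qed.

End QuotientConditions.

(** * Induction on the number of points *)

Lemma joing_2group {T : finType} (x : {perm T}) (P Q : {group {perm T}}) :
    few_fixed x -> distinct_cycles x -> x \in P -> x \in Q ->
  2.-group P -> 2.-group Q -> 2.-group (P <*> Q).
Proof.
have [m] := ubnP #|T|; elim: m T x P Q => // m IHm T x P Q ltTm ffx dcx Px Qx pP pQ.
have [z cPz nz] := near_fpf_involution_exists P pP.
have [z' cQz' nz'] := near_fpf_involution_exists Q pQ.
have czx : commute z x by apply: (centP cPz).
have zz' : z' = z.
  by apply: (near_fpf_unique T x) => //; apply: (centP cQz').
have z2 : z ^+ 2 = 1 by case: nz.
(* Base case: [z = 1] forces [T] to have at most one point. *)
have [z1 | z1] := eqVneq z 1.
  have T1 (u v : T) : u = v by case: nz => _; apply; rewrite z1 perm1.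
  suff -> : P <*> Q = 1 by apply: pgroup1.
  by apply/trivgP/subsetP=> g _; rewrite inE; apply/eqP/permP.
have sPQz : P <*> Q \subset 'C[z].
  by rewrite join_subG !sub_cent1 cPz -zz'.
have sPQD := subset_trans sPQz (cent1_sub_orbit_dom T z z2).
rewrite -(pmorphim_pgroup (orbit_perm_ker_2group T z z2) sPQD).
have [sPD sQD] := joing_subP sPQD.
rewrite morphimY //.
apply: (IHm _ (orbit_perm T z x) (orbit_perm T z @* P)%G (orbit_perm T z @* Q)%G).
- exact: leq_trans (card_orbit_quotient T z z1) _.
- exact: few_fixed_quotient.
- exact: distinct_cycles_quotient.
- by apply: mem_morphim => //; apply: (subsetP sPD).
- by apply: mem_morphim => //; apply: (subsetP sQD).
- exact: morphim_pgroup.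
- exact: morphim_pgroup.
Qed.

(** * Permutations in a unique Sylow 2-subgroup *)

(** The conjugates of [t] under [<[x]>] generate an abelian 2-group [E] normalised by [x], so [<[x]>
    <*> E] is a 2-group containing [t]. *)
Lemma commuting_conjugates_2group (gT : finGroupType) (x t : gT) :
    2.-elt x -> 2.-elt t -> (forall i, commute t (t ^ (x ^+ i))) ->
  2.-group (<[x]> <*> <[t]>).
Proof.
move=> px pt ct; pose E := << t ^: <[x]> >>.
have cE : abelian E.
  rewrite abelian_gen; apply/centsP=> _ /imsetP[_ /cycleP[i ->] ->].
  move=> _ /imsetP[_ /cycleP[j ->] ->]; set y := x ^+ i.
  (* Conjugating by [y] reduces a pair of conjugates to [t] and one conjugate of [t]. *)
  have yK : x ^+ j = (x ^+ j * y^-1) * y by rewrite mulgKV.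
  have: x ^+ j * y^-1 \in <[x]> by rewrite groupM ?groupV ?mem_cycle.
  by case/cycleP=> k yk; rewrite yK yk conjgM /commute -!conjMg (ct k).
have pE : 2.-group E.
  have HE := nilpotent_pcore_Hall 2 (abelian_nil cE).
  apply: pgroupS (pcore_pgroup 2 E); rewrite gen_subG; apply/subsetP=> s ts.
  rewrite (mem_Hall_pcore HE) ?mem_gen //.
  by case/imsetP: ts => y _ ->; rewrite p_eltJ.
have nE : <[x]> \subset 'N(E) by rewrite norms_gen // class_norm.
apply: (@pgroupS _ _ (<[x]> <*> E)).
  by rewrite genS // setUS // cycle_subG mem_gen // class_refl.
by rewrite /= norm_joinEl // pgroupM pE andbT.
Qed.

(** The hypotheses say that [x ^+ i] maps the pair [u], [v] onto itself or onto a disjoint pair. *)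
Lemma tperm_disjoint_commute {T : finType} (x : {perm T}) u v i :
    ((x ^+ i) u == u) = ((x ^+ i) v == v) ->
    ((x ^+ i) u == v) = ((x ^+ i) v == u) ->
  commute (tperm u v) (tperm u v ^ (x ^+ i)).
Proof.
rewrite tpermJ; set u' := (x ^+ i) u; set v' := (x ^+ i) v => eq_fix eq_swap.
apply/commgP/conjg_fixP; rewrite tpermJ.
have [u'u | u'u] := eqVneq u' u.
  have /eqP-> : v' == v by rewrite -eq_fix u'u.
  by rewrite u'u tpermL tpermR tpermC.
have [u'v | u'v] := eqVneq u' v.
  have /eqP-> : v' == u by rewrite -eq_swap u'v.
  by rewrite u'v tpermL tpermR tpermC.
by rewrite !tpermD //; [rewrite -eq_fix | rewrite -eq_swap].
Qed.

Lemma tperm_mul_3cycle {T : finType} (u v w : T) :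
  u != v -> v != w -> w != u -> ~~ 2.-elt (tperm u v * tperm u w).
Proof.
move=> uv vw wu; set g := _ * _; apply/negP=> pg.
have gu : g u = v by rewrite permM tpermL tpermD // eq_sym.
have gv : g v = w by rewrite permM tpermR tpermL.
have gw : g w = u by rewrite permM (@tpermD _ u v w) ?tpermR // eq_sym.
have cg : 3 %| #|porbit g u|.
  have c3 : #|porbit g u| %| 3 by rewrite -porbit_expE permX /= gu gv gw.
  have : #|porbit g u| != 1%N by rewrite card_porbit_eq1 gu eq_sym.
  by case/primeP: (isT : prime 3) => _ /(_ _ c3)/orP[]/eqP->.
have c2 : #|porbit g u| %| #[g] by rewrite -porbit_expE expg_order perm1.
by have /pnatP-/(_ (order_gt0 g) 3 isT (dvdn_trans cg c2)) := pg.
Qed.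

Section UniqueSylow.
Variables (n : nat) (x : 'S_n) (P : {group 'S_n}).
Hypothesis px : 2.-elt x.
Hypothesis uP : [set Q in 'Syl_2([set: 'S_n]) | x \in Q] = [set P].

Let pP : 2.-group P.
Proof.
have := set11 P; rewrite -uP !inE => /andP[+ _].
by rewrite pHallE => /andP[_ /eqP oP]; rewrite /pgroup oP part_pnat.
Qed.

Lemma unique_sylow_superset (H : {group 'S_n}) : 2.-group H -> x \in H -> H \subset P.
Proof.
move=> pH Hx; have [Q sQ sHQ] := Sylow_superset (subsetT H) pH.
have: Q \in [set P] by rewrite -uP !inE sQ (subsetP sHQ).
by move/set1P <-.
Qed.

Lemma unique_sylow_tperm u v :
    (forall i, ((x ^+ i) u == u) = ((x ^+ i) v == v)) ->
    (forall i, ((x ^+ i) u == v) = ((x ^+ i) v == u)) ->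
  tperm u v \in P.
Proof.
move=> efix eswap; pose H := (<[x]> <*> <[tperm u v]>)%G.
have pH : 2.-group H.
  apply: commuting_conjugates_2group => //.
    rewrite /p_elt (@pnat_dvd _ 2) // order_dvdn expgS expg1.
    by apply/eqP/permP=> a; rewrite permM tpermK perm1.
  by move=> i; apply: tperm_disjoint_commute.
have sxH : <[x]> \subset H := joing_subl _ _.
have stH : <[tperm u v]> \subset H := joing_subr _ _.
rewrite -cycle_subG (subset_trans stH) // unique_sylow_superset //.
by rewrite -cycle_subG.
Qed.

Lemma unique_sylow_no_triangle u v w : u != v -> v != w -> w != u ->
  tperm u v \in P -> tperm u w \in P -> False.
Proof.
move=> uv vw wu Puv Puw; apply/negP: (tperm_mul_3cycle u v w uv vw wu).
by apply/negPn; apply: mem_p_elt pP _; rewrite groupM.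
Qed.

Lemma unique_sylow_few_fixed : few_fixed x.
Proof.
move=> u v w xu xv xw; apply: contraT; rewrite !negb_or => /and3P[uv vw wu].
have fixX a i : x a = a -> (x ^+ i) a = a.
  by move=> xa; elim: i => [|i IHi]; rewrite ?perm1 // expgS permM xa.
by case: (unique_sylow_no_triangle u v w) => //; apply: unique_sylow_tperm => i;
  rewrite !fixX ?eqxx // eq_sym.
Qed.

Lemma unique_sylow_distinct_cycles : distinct_cycles x.
Proof.
move=> u v mu eqc; apply: contraT => nuv.
set N := #|porbit x u| in eqc.
(* [N] divides the order of the 2-element [x], so it is a power of 2, and it exceeds 1. *)
have [k dk] : exists k, N = k.*2.
  have dvN : N %| #[x] by rewrite -porbit_expE expg_order perm1.
  have /p_natP[m] := pnat_dvd dvN px.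
  case: m => [|m] eN; last by exists (2 ^ m)%N; rewrite eN expnS mul2n.
  by move: mu; rewrite card_porbit_gt1 -/N eN.
pose u' := (x ^+ k) u.
have N0 : 0 < N := card_porbit_gt0 x u.
have cxk : commute (x ^+ k) x by apply/commute_sym/commuteX.
have u'u : u' != u.
  by rewrite porbit_expE -/N dk; apply/negP=> /dvdn_leq; lia.
have vu i : (x ^+ i) u == v = false.
  by apply: contraNF nuv => /eqP <-; apply: mem_porbit.
have uv i : (x ^+ i) v == u = false.
  apply: contraNF nuv => /eqP <-; rewrite -eq_porbit_mem.
  by rewrite eq_sym eq_porbit_mem mem_porbit.
case: (unique_sylow_no_triangle u u' v).
- by rewrite eq_sym.
- by rewrite vu.
- by have := uv 0; rewrite perm1 => ->.
- apply: unique_sylow_tperm => i.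
    by rewrite !porbit_expE card_porbit_commute.
  (* Applying [x ^+ k] to [(x ^+ i) u = u'] turns it into [(x ^+ i) u' = u], because [2k = N]. *)
  rewrite -(inj_eq (@perm_inj _ (x ^+ k))) -permM -expgD addnC expgD permM.
  have -> // : (x ^+ k) u' = u.
  by apply/eqP; rewrite /u' -permM -expgD porbit_expE addnn -dk.
(* No power of [x] exchanges points of different cycles, and equal lengths make the same powers fix
   [u] and [v]. *)
- by apply: unique_sylow_tperm => i; rewrite ?vu ?uv // !porbit_expE -eqc.
Qed.

End UniqueSylow.

(** * Translation of the cycle conditions and the equivalence *)

Lemma distinct_cyclesP n (x : 'S_n) :
  nontriv_cycle_lengths_distinct x <-> distinct_cycles x.
Proof.
split=> [dc u v mu eqc | dc A B].
  rewrite -eq_porbit_mem; apply/eqP; apply: dc; rewrite ?imset_f //.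
  by rewrite -eqc -card_porbit_gt1.
case/imsetP=> u _ -> /imsetP[v _ ->]; rewrite -card_porbit_gt1 => mu eqc.
by apply/eqP; rewrite eq_sym eq_porbit_mem dc.
Qed.

Lemma few_fixedP n (x : 'S_n) : #|fixed_points x| <= 2 <-> few_fixed x.
Proof.
split=> [le2 u v w xu xv xw | ff].
  apply: contraLR le2; rewrite !negb_or -ltnNge => /and3P[uv vw wu].
  by apply/card_gt2P; exists u, v, w; rewrite !inE xu xv xw.
rewrite leqNgt; apply/card_gt2P=> -[u [v [w [[]]]]].
rewrite !inE => /eqP xu /eqP xv /eqP xw [uv vw wu].
by have := ff u v w xu xv xw; rewrite (negPf uv) (negPf vw) (negPf wu).
Qed.

Theorem theoremC (n : nat) (hn : (2 <= n)%N) (x : 'S_n) (hx : 2.-elt x) :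
  #|[set P in 'Syl_2([set: 'S_n]) | x \in P]| = 1%N <->
  (#|fixed_points x| <= 2%N /\ nontriv_cycle_lengths_distinct x).
Proof.
split=> [/eqP/cards1P[P uP] | [/few_fixedP ff /distinct_cyclesP dc]].
  split; first exact/few_fixedP/(unique_sylow_few_fixed n x P).
  exact/distinct_cyclesP/(unique_sylow_distinct_cycles n x P).
have [P sP xP] := Sylow_superset (subsetT <[x]>) hx.
rewrite cycle_subG in xP.
apply/eqP/cards1P; exists P; apply/setP=> Q; rewrite !inE.
apply/andP/eqP=> [[sQ xQ] | ->] //.
(* Sylow subgroups are maximal 2-subgroups, so [P] and [Q] both equal the 2-group [P <*> Q]. *)
have pPQ := joing_2group x P Q ff dc xP xQ (pHall_pgroup sP) (pHall_pgroup sQ).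
have eP := sub_pHall (K := (P <*> Q)%G) sP pPQ (joing_subl _ _) (subsetT _).
have eQ := sub_pHall (K := (P <*> Q)%G) sQ pPQ (joing_subr _ _) (subsetT _).
by apply: val_inj; apply: etrans (esym eQ) eP.
Qed.
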